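(* Let $G$ be a finite abelian group and $p$ a prime dividing $|G|$ such that the Sylow $p$-subgroup $G_p$ is cyclic and $p$ is self-conjugate modulo $\exp(G)$. Suppose $S$ and $T$ form a primitive formally dual pair in $G$, and let $l_1,l_2\ge0$ be such that $p^{l_1}$ and $p^{l_2}$ are the exact powers of $p$ dividing $|S|$ and $|T|$, respectively. Then $l_1=l_2=1$, and consequently $p^2$ is the exact power of $p$ dividing $|G|$.
   Context: Write $n=p^bn'$ with $p\nmid n'$; $p$ is self-conjugate modulo $n$ if there is a nonnegative integer $j$ with $p^j\equiv-1\pmod{n'}$. $\exp(G)$ is the exponent of $G$. For a group isomorphism $\Delta:G\to\widehat G$, $y\mapsto\chi_y$, subsets $S,T\subseteq G$ form a formally dual pair if for all $y\in G$: $|\chi_y(S)|^2=\frac{|S|^2}{|T|}\nu_T(y)$ and $|\chi_y(T)|^2=\frac{|T|^2}{|S|}\nu_S(y)$, where $\chi(A)=\sum_{a\in A}\chi(a)$ and $\nu_A(y)=|\{(a_1,a_2)\in A\times A\mid y=a_1a_2^{-1}\}|$. A subset is primitive if it is not contained in a coset of a proper subgroup and is not a union of cosets of a nontrivial subgroup; the pair is primitive if both sets are primitive. *)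

(* Defs.v *)
From mathcomp Require Import all_boot all_order all_algebra all_fingroup.
From mathcomp Require Import all_solvable all_field all_character.

Set Implicit Arguments.
Unset Strict Implicit.
Unset Printing Implicit Defensive.

Import GroupScope.

(* n`_p^' is the factor n' in n = p ^ b * n' with p not dividing n'. *)
Definition self_conjugate (p n : nat) : Prop :=
  exists j : nat, (p%:Z ^+ j = -1 %[mod (n`_p^')%N])%Z%R.

(* The dual group of an abelian group G is represented by the linear
   characters in 'CF(G), under pointwise multiplication. *)
Definition dual_isomorphism (gT : finGroupType) (G : {group gT})
    (Delta : gT -> 'CF(G)) : Prop :=
  [/\ {in G, forall y, Delta y \is a linear_char},
      {in G &, forall y z, Delta (y * z) = (Delta y * Delta z)%R},
      {in G &, injective Delta}
    & forall xi : 'CF(G), xi \is a linear_char ->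
        exists2 y, y \in G & Delta y = xi].

Definition char_sum (gT : finGroupType) (G : {group gT}) (chi : 'CF(G))
    (A : {set gT}) : algC :=
  (\sum_(a in A) chi a)%R.

Definition weight (gT : finGroupType) (A : {set gT}) (y : gT) : nat :=
  #|[set a in setX A A | y == a.1 * a.2^-1]|.

Definition formally_dual (gT : finGroupType) (G : {group gT})
    (Delta : gT -> 'CF(G)) (S T : {set gT}) : Prop :=
  [/\ S \subset G, T \subset G
    & {in G, forall y,
        (`|char_sum (Delta y) S| ^+ 2
           = #|S|%:R ^+ 2 / #|T|%:R * (weight T y)%:R)%R
      /\ (`|char_sum (Delta y) T| ^+ 2
           = #|T|%:R ^+ 2 / #|S|%:R * (weight S y)%:R)%R}].

Definition primitive_subset (gT : finGroupType) (G : {group gT})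
    (A : {set gT}) : Prop :=
  (forall (H : {group gT}) (x : gT),
     H \proper G -> x \in G -> ~~ (A \subset H :* x))
  /\ (forall (H : {group gT}) (C : {set {set gT}}),
     H \subset G -> H :!=: 1 -> C \subset rcosets H G -> A <> cover C).

(* Main.v *)
(* Since |S| |T| = |G|, it suffices to show 2 l1 <= l2 + 1 and, symmetrically,
   2 l2 <= l1 + 1.  Suppose 2 l1 >= l2 + 2; then the duality makes p^2 divide
   |chi(S)|^2 for every character chi.  With z a primitive exp(G)-th root of
   unity and w its p-part, self-conjugacy means that complex conjugation acts
   as a power of Frobenius on the reduced ring Z[z] / (1 - w); as p is a power
   of 1 - w up to a unit, descending along powers of 1 - w gives p | chi(S) in
   Z[z] (Turyn).  Let g be an element of order p.  When G_p is cyclic and chi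
   is faithful on it, (1 - chi(g)) Z[z] has trace in |G_p| Z[z], so Fourier
   inversion on the p-part shows that the contributions of x and g x to the
   Fourier coefficients of S agree modulo p (Ma's lemma); inverting on the
   p'-part, S is invariant under g and hence is not primitive. *)

From HB Require Import structures.
Require Import Defs.
From mathcomp Require Import all_boot all_order all_algebra all_fingroup.
From mathcomp Require Import all_solvable all_field all_character.
From mathcomp Require Import ring zify.

Set Implicit Arguments.
Unset Strict Implicit.
Unset Printing Implicit Defensive.

Import Order.TTheory GRing.Theory Num.Theory.
Local Open Scope ring_scope.

(** * Frobenius congruences for integer polynomials *)

Lemma exprD_prime (R : comNzRingType) (p : nat) (a b : R) : prime p ->
  exists r, (a + b) ^+ p = a ^+ p + b ^+ p + p%:R * r.
Proof.
case: p => // p p_pr; have p_gt0 : (0 < p)%N by case: p p_pr.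
pose c i := ('C(p.+1, bump 0 i) %/ p.+1)%N.
exists (\sum_(i < p) a ^+ (p.+1 - bump 0 i) * b ^+ bump 0 i *+ c i).
rewrite exprDn big_ord_recl big_ord_recr /= subn0 expr0 mulr1 bin0 mulr1n.
rewrite -addrA; congr (_ + _); rewrite addrC.
rewrite /bump /= add1n subnn expr0 mul1r binn mulr1n; congr (_ + _).
rewrite mulr_sumr; apply: eq_bigr => i _.
rewrite mulr_natl -mulrnA divnK // prime_dvd_bin //=.
by have := ltn_ord i; rewrite /bump; lia.
Qed.

Lemma fermat_int (p : nat) (c : int) : prime p ->
  exists d : int, c ^+ p = c + p%:R * d.
Proof.
move=> p_pr; have p_gt0 := prime_gt0 p_pr.
have Dn (n : nat) : exists d : int, n%:R ^+ p = n%:R + p%:R * d.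
  elim: n => [|n [d IHn]]; first by exists 0; rewrite expr0n gtn_eqF // mulr0.
  have [r Dr] := exprD_prime n%:R (1 : int) p_pr.
  by exists (d + r); rewrite -natr1 Dr IHn expr1n; ring.
case: (intP c) => [|n|n].
- by exists 0; rewrite expr0n gtn_eqF // mulr0.
- by have [d] := Dn n.+1; rewrite natz; exists d.
(* Expanding the p-th power of (n+1) + (-(n+1)) = 0 settles negative integers for p = 2 and odd p
   alike. *)
have [d Dd] := Dn n.+1; have [r] := exprD_prime n.+1%:R (- n.+1%:R : int) p_pr.
rewrite subrr expr0n gtn_eqF //= Dd -[X in _ = X + _]addrA => Dr; exists (- d - r).
rewrite -natz in Dr *.
by rewrite -[LHS]subr0 [X in _ - X = _]Dr; ring.
Qed.

(** Frobenius fixes coefficients modulo p by [fermat_int]. The multiple of p is kept explicit so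
    that the congruence can be evaluated at a root of unity. *)
Lemma expr_comp_polyXn (p k : nat) (q : {poly int}) : prime p ->
  exists r, q ^+ (p ^ k) = q \Po 'X^(p ^ k) + p%:R * r.
Proof.
move=> p_pr.
have step (f : {poly int}) : exists r, f ^+ p = f \Po 'X^p + p%:R * r.
  elim/poly_ind: f => [|f c [r IHf]].
    by exists 0; rewrite expr0n gtn_eqF ?prime_gt0 // comp_poly0 mulr0 addr0.
  have [d Dd] := fermat_int c p_pr.
  have [s ->] := exprD_prime (f * 'X) c%:P p_pr.
  exists (r * 'X^p + d%:P + s).
  rewrite exprMn IHf -rmorphXn /= Dd comp_poly_MXaddC !rmorphD rmorphM rmorph_nat /=.
  by ring.
elim: k => [|k [r IHk]]; first by exists 0; rewrite expn0 !expr1 comp_polyXr mulr0 addr0.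
have [s Ds] := step (q \Po 'X^(p ^ k)).
have [t Dt] := exprD_prime (q \Po 'X^(p ^ k)) (p%:R * r) p_pr.
exists (s + t + p%:R ^+ p.-1 * r ^+ p).
rewrite expnSr exprM IHk Dt Ds -comp_polyA comp_Xn_poly -exprM mulnC exprMn.
have -> : p%:R ^+ p = p%:R * p%:R ^+ p.-1 :> {poly int}.
  by rewrite -exprS prednK ?prime_gt0.
by ring.
Qed.

(** * Ramification of p in the rings Z[z] *)

(** The product is the value at 1 of the cyclotomic polynomial (X^(p^(b+1)) - 1) / (X^(p^b) - 1), a
    geometric sum of p terms, each equal to 1 there. *)
Lemma prod_1_sub_prim_root (p b : nat) (w : algC) :
    prime p -> (p ^ b.+1).-primitive_root w ->
  \prod_(k < p ^ b.+1 | ~~ (p %| k)%N) (1 - w ^+ k) = p%:R.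
Proof.
move=> p_pr prim_w; have p_gt0 := prime_gt0 p_pr.
have prim_wp : (p ^ b).-primitive_root (w ^+ p).
  have := dvdn_prim_root prim_w (dvdn_exp2l p (leqnSn b)).
  by rewrite expnS mulnK ?expn_gt0 ?p_gt0.
have := factor_Xn_sub_1 prim_w; rewrite big_mkord.
rewrite (bigID (fun k : 'I__ => (p %| k)%N)) /=.
(* The w^k with p | k are exactly the p^b-th roots of unity. *)
rewrite (_ : \prod_(k < p ^ b.+1 | (p %| k)%N) _ = 'X^(p ^ b) - 1); last first.
  rewrite -(factor_Xn_sub_1 prim_wp) big_mkord.
  have lt_h (i : 'I_(p ^ b)) : (p * i < p ^ b.+1)%N.
    by rewrite expnS ltn_pmul2l.
  have lt_h' (i : 'I_(p ^ b.+1)) : (i %/ p < p ^ b)%N.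
    by rewrite ltn_divLR // -expnSr.
  rewrite (reindex_onto (fun i => Ordinal (lt_h i)) (fun i => Ordinal (lt_h' i))) /=.
    apply: eq_big => [i|i _]; last by rewrite exprM.
    by rewrite dvdn_mulr //=; apply/eqP/val_inj; rewrite /= mulKn.
  by move=> i p_i; apply/val_inj; rewrite /= mulnC divnK.
rewrite [X in _ = 'X^X - 1]expnSr exprM -[1 in RHS](expr1n _ p) subrXX => /(mulfI _) Dprod.
have pb_gt0 : (0 < p ^ b)%N by rewrite expn_gt0 p_gt0.
have nz : 'X^(p ^ b) - 1 != 0 :> {poly algC}.
  by rewrite -polyC1 monic_neq0 ?monicXnsubC.
have /(congr1 (horner^~ 1)) := Dprod nz.
rewrite horner_prod horner_sum => Dp.
under eq_bigr do rewrite -hornerXsubC.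
rewrite Dp; under eq_bigr do rewrite expr1n mulr1 -exprM hornerXn expr1n.
by rewrite sumr_const card_ord.
Qed.

(** The image of this morphism is Z[z]. Divisibility in Z[z] is expressed by a polynomial cofactor,
    and Galois conjugation by a change of z. *)
Definition Zval (z : algC) : {poly int} -> algC :=
  horner_eval z \o map_poly intr.
HB.instance Definition _ (z : algC) := GRing.RMorphism.on (Zval z).

Lemma Zval_Xn (z : algC) (k : nat) : Zval z 'X^k = z ^+ k.
Proof. by rewrite /Zval /= map_polyXn /horner_eval hornerXn. Qed.

Lemma Zval_comp_Xn (z : algC) (k : nat) (q : {poly int}) :
  Zval z (q \Po 'X^k) = Zval (z ^+ k) q.
Proof.
by rewrite /Zval /= map_comp_poly map_polyXn /horner_eval horner_comp hornerXn.
Qed.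

Lemma rmorph_Zval (u : {rmorphism algC -> algC}) (z : algC) (q : {poly int}) :
  u (Zval z q) = Zval (u z) q.
Proof.
rewrite /Zval /= /horner_eval -horner_map -map_poly_comp /=; congr (_.[_]).
by apply: eq_map_poly => a /=; rewrite rmorph_int.
Qed.

(** The inverse is written as a natural power so that conjugation becomes the substitution of
    X^(n-1) in polynomials. *)
Lemma conj_prim_root (z : algC) (n : nat) :
  n.-primitive_root z -> z^* = z ^+ n.-1.
Proof.
move=> prim_z; have n_gt0 := prim_order_gt0 prim_z.
have z1 : `|z| = 1.
  apply/eqP; rewrite -(@pexpr_eq1 _ _ n) // -normrX.
  by rewrite prim_expr_order ?normr1.
have z_nz : z != 0 by rewrite -normr_eq0 z1 oner_eq0.
apply: (mulfI z_nz); rewrite -normCK z1 expr1n -exprS prednK //.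
by rewrite prim_expr_order.
Qed.

Lemma comp_polyB_dvd (q u v : {poly int}) :
  exists r, q \Po u - (q \Po v) = (u - v) * r.
Proof.
elim/poly_ind: q => [|q c [r IHq]]; first by exists 0; rewrite !comp_poly0 subrr mulr0.
exists ((q \Po u) + v * r); rewrite !comp_poly_MXaddC.
rewrite (_ : _ - _ = (u - v) * (q \Po u) + v * (q \Po u - (q \Po v))); last by ring.
by rewrite IHq; ring.
Qed.

(** Modulo 1 - X^m one has X^m = 1. For m = n', the p'-part of n, evaluation at z turns this into a
    congruence modulo 1 - w with w = z^(n'). *)
Lemma comp_Xn_congr (q : {poly int}) (m i k : nat) : i = k %[mod m] ->
  exists r, q \Po 'X^i - (q \Po 'X^k) = (1 - 'X^m) * r.
Proof.
move=> eq_ik; have [r ->] := comp_polyB_dvd q 'X^i 'X^k.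
have Xmod (j : nat) : exists s : {poly int}, 'X^j - 'X^(j %% m) = (1 - 'X^m) * s.
  exists (- 'X^(j %% m) * \sum_(l < j %/ m) 'X^m ^+ ((j %/ m).-1 - l) * 1 ^+ l).
  rewrite {1}(divn_eq j m) addnC exprD mulnC exprM.
  have := subrXX ('X^m : {poly int}) 1 (j %/ m).
  set a := _ ^+ (j %/ m); set b := \sum_(_ < _) _; rewrite expr1n => Da.
  transitivity ('X^(j %% m) * (a - 1)); first by rewrite mulrBr mulr1.
  by rewrite Da; ring.
have [[s Ds] [t Dt]] := (Xmod i, Xmod k); exists ((s - t) * r).
rewrite -eq_ik in Dt; rewrite mulrA mulrBr -Ds -Dt; ring.
Qed.
Lemma Zval_1_sub (z : algC) (m : nat) : Zval z (1 - 'X^m) = 1 - z ^+ m.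
Proof. by rewrite rmorphB rmorph1 /= Zval_Xn. Qed.

Lemma prod_Zval (I : finType) (P : pred I) (w c : algC) (F : I -> algC) :
    (forall i, P i -> exists r, F i = c * Zval w r) ->
  exists r, \prod_(i | P i) F i = c ^+ #|P| * Zval w r.
Proof.
move=> DF; rewrite -prodr_const; apply: (big_ind2 (fun x y => exists r, x = y * Zval w r)).
- by exists 1; rewrite rmorph1 mulr1.
- by move=> x1 x2 y1 y2 [r ->] [s ->]; exists (r * s); rewrite rmorphM; ring.
by move=> i /DF.
Qed.

Lemma prod_Zval_dvd (I : finType) (P : pred I) (w c : algC) (F : I -> algC) :
    (forall i, P i -> exists r, c = F i * Zval w r) ->
  exists r, c ^+ #|P| = \prod_(i | P i) F i * Zval w r.
Proof.
move=> DF; rewrite -prodr_const; apply: (big_ind2 (fun x y => exists r, x = y * Zval w r)).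
- by exists 1; rewrite rmorph1 mulr1.
- by move=> x1 x2 y1 y2 [r ->] [s ->]; exists (r * s); rewrite rmorphM; ring.
by move=> i /DF.
Qed.

Lemma Zval_1_sub_Xn (w : algC) (k : nat) : exists r, 1 - w ^+ k = (1 - w) * Zval w r.
Proof.
exists (\sum_(i < k) 'X^i); rewrite rmorph_sum -opprB subrX1 -mulNr opprB.
by congr (_ * _); apply: eq_bigr => i _; rewrite -(Zval_Xn w i).
Qed.

(* (p) = (1 - w)^e, where e is the totient of p^(b+1). *)
Lemma prime_totally_ramified (p b : nat) (w : algC) :
    prime p -> (p ^ b.+1).-primitive_root w ->
  exists e r s, [/\ (0 < e)%N, p%:R = (1 - w) ^+ e * Zval w r
    & (1 - w) ^+ e = p%:R * Zval w s].
Proof.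
move=> p_pr prim_w; have p_gt0 := prime_gt0 p_pr.
pose P := [pred k : 'I_(p ^ b.+1) | ~~ (p %| k)%N].
have [r Dr] := @prod_Zval _ P w (1 - w) (fun k => 1 - w ^+ k) (fun k _ => Zval_1_sub_Xn w k).
have [|s Ds] := @prod_Zval_dvd _ P w (1 - w) (fun k => 1 - w ^+ k).
  move=> k /= p'k.
  have co_pk : coprime k (p ^ b.+1) by rewrite coprimeXr // coprime_sym prime_coprime.
  have q_gt0 : (0 < p ^ b.+1)%N by rewrite expn_gt0 p_gt0.
  have k_gt0 : (0 < k)%N by case: {+}(k : nat) p'k; rewrite ?dvdn0.
  (* By Bezout, l inverts k modulo p^(b+1), so w = (w^k)^l and 1 - w^k divides 1 - w. *)
  have [l l' Dl _] := egcdnP (p ^ b.+1) k_gt0.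
  have [t Dt] := Zval_1_sub_Xn (w ^+ k) l.
  exists (t \Po 'X^k); rewrite Zval_comp_Xn -Dt -exprM mulnC Dl.
  by rewrite (eqP co_pk) exprD expr1 mulnC exprM (prim_expr_order prim_w) expr1n mul1r.
exists #|P|, r, s; rewrite -(prod_1_sub_prim_root p_pr prim_w).
split; [|by rewrite Dr|by rewrite Ds].
have lt1 : (1 < p ^ b.+1)%N by rewrite -(exp1n b.+1) ltn_exp2r ?prime_gt1.
by apply/card_gt0P; exists (Ordinal lt1); rewrite inE /= dvdn1 gtn_eqF ?prime_gt1.
Qed.

(** Since p | n, the root w = z^(n') has order a positive power of p; the relations in Z[w] pass to
    Z[z] by substituting X^(n'). *)
Lemma prime_ramified_prim_root (n p : nat) (z : algC) :
    n.-primitive_root z -> prime p -> (p %| n)%N ->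
  exists e r s, [/\ (0 < e)%N, p%:R = (1 - z ^+ (n`_p^')%N) ^+ e * Zval z r
    & (1 - z ^+ (n`_p^')%N) ^+ e = p%:R * Zval z s].
Proof.
move=> prim_z p_pr p_n; have n_gt0 := prim_order_gt0 prim_z.
have [b Db] : exists b, (n`_p = p ^ b.+1)%N.
  exists (logn p n).-1; rewrite prednK ?p_part //.
  by rewrite logn_gt0 mem_primes p_pr n_gt0.
have prim_w : (p ^ b.+1).-primitive_root (z ^+ (n`_p^')%N).
  have := dvdn_prim_root prim_z (dvdn_part p n).
  by rewrite -{2}(partnC p n_gt0) mulKn ?part_gt0 // Db.
have [e [r [s [e_gt0 Dp De]]]] := prime_totally_ramified p_pr prim_w.
exists e, (r \Po 'X^(n`_p^'%N)), (s \Po 'X^(n`_p^'%N)).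
by rewrite !Zval_comp_Xn.
Qed.

(** * Self-conjugacy and Turyn's divisibility argument *)

(** As 1 - w divides p, the Frobenius congruence holds modulo 1 - w, where exponents of z matter
    only modulo n'. There p^j is -1, which gives conjugation, and p^(2j) is 1; the second congruence
    is what makes Z[z] / (1 - w) reduced. *)
Lemma Frobenius_self_conjugate (n p j : nat) (z : algC) (q : {poly int}) :
    n.-primitive_root z -> prime p -> (p %| n)%N ->
    (p ^ j = n.-1 %[mod n`_p^'])%N ->
  let L := 1 - 'X^(n`_p^'%N) : {poly int} in
  (exists r, Zval z (q \Po 'X^(n.-1)) = Zval z (q ^+ (p ^ j) + L * r)) /\
  (exists r, Zval z (q ^+ (p ^ (2 * j))) = Zval z (q + L * r)).
Proof.
move=> prim_z p_pr p_n Dj L; have n_gt0 := prim_order_gt0 prim_z.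
have [[|e] [r [_ [//= _ Dp _]]]] := prime_ramified_prim_root prim_z p_pr p_n.
have{Dp r} [r Dp] : exists r, p%:R = Zval z (L * r).
  exists (L ^+ e * r); rewrite mulrA -exprS rmorphM rmorphXn /=.
  by rewrite Zval_1_sub.
have Frob (k i : nat) : (p ^ k = i %[mod n`_p^'])%N ->
    exists t, Zval z (q ^+ (p ^ k)) = Zval z ((q \Po 'X^i) + L * t).
  move=> Dk; have [t ->] := expr_comp_polyXn k q p_pr.
  have [t' Dt'] := comp_Xn_congr q Dk; exists (t' + r * t).
  rewrite rmorphD rmorphM rmorph_nat Dp -rmorphM -rmorphD; congr (Zval z _).
  by rewrite -(subrK (q \Po 'X^i) (q \Po 'X^(p ^ k))) Dt' -/L; ring.
split.
  have [t Dt] := Frob j _ Dj; exists (- t).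
  by move: Dt; rewrite !rmorphD /= => ->; rewrite mulrN rmorphN /= addrK.
have [|t ->] := Frob (2 * j)%N 1%N; last by exists t; rewrite comp_polyXr.
have n_gt1 : (1 < n)%N by rewrite (leq_trans (prime_gt1 p_pr)) // dvdn_leq.
rewrite mulnC expnM -modnXm Dj modnXm.
rewrite (_ : n.-1 ^ 2 = (n - 2) * n + 1)%N; last first.
  by move: n_gt1; clear; nia.
by rewrite -modnDml -modnMmr (eqP (dvdn_part _ n)) muln0 mod0n.
Qed.
Lemma conj_Zval (n : nat) (z : algC) (q : {poly int}) :
  n.-primitive_root z -> (Zval z q)^* = Zval z (q \Po 'X^(n.-1)).
Proof.
by move=> prim_z; rewrite Zval_comp_Xn -(conj_prim_root prim_z) rmorph_Zval.
Qed.

(* Conjugation acts as a power of Frobenius on the reduced ring Z[z] / (1 - w),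
   where w is the p-part of z. *)
Lemma dvd_of_dvd_norm (n p j : nat) (z : algC) (q s : {poly int}) :
    n.-primitive_root z -> prime p -> (p %| n)%N -> (0 < j)%N ->
    (p ^ j = n.-1 %[mod n`_p^'])%N ->
    Zval z q * (Zval z q)^* = (1 - z ^+ (n`_p^')%N) * Zval z s ->
  exists r, Zval z q = (1 - z ^+ (n`_p^')%N) * Zval z r.
Proof.
move=> prim_z p_pr p_n j_gt0 Dj; rewrite (conj_Zval _ prim_z) => Dqs.
have [[r Dr] [t Dt]] := Frobenius_self_conjugate q prim_z p_pr p_n Dj.
(* Modulo 1 - w, Q equals Q^(p^(2j)). As j > 0, this power contains the factor Q Q^(p^j), congruent
   to Q times its conjugate, hence to 0. *)
have le_exp : ((p ^ j).+1 <= p ^ (2 * j))%N.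
  by rewrite ltn_exp2l ?prime_gt1 // mul2n -addnn -[X in (X < _)%N]add0n ltn_add2r.
move: Dqs Dr Dt; rewrite -(subnK le_exp) exprD exprS -Zval_1_sub.
set L := 1 - 'X^(_); set N := (_ - _)%N; clearbody L => Dqs Dr Dt.
exists (q ^+ N * (s - q * r) - t); move: Dqs Dr Dt.
rewrite !(rmorphD, rmorphB, rmorphM, rmorphXn, rmorphN) /=.
set Q := Zval z q; set Q' := Zval z (_ \Po _); set l := Zval z L.
set A := Zval z s; set B := Zval z r; set C := Zval z t => Dqs DQ Dt.
transitivity (Q ^+ N * (Q * Q ^+ (p ^ j)) - l * C); first by rewrite Dt addrK.
have -> : Q * Q ^+ (p ^ j) = l * A - Q * l * B by rewrite -Dqs DQ; ring.
ring.
Qed.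

(** Each step divides Q by 1 - w. The conjugate of 1 - w is -w^-1 (1 - w), so the product of Q with
    its conjugate loses two factors 1 - w, up to a unit. *)
Lemma dvd_exp_of_dvd_norm (n p j k : nat) (z : algC) (q s : {poly int}) :
    n.-primitive_root z -> prime p -> (p %| n)%N -> (0 < j)%N ->
    (p ^ j = n.-1 %[mod n`_p^'])%N ->
    Zval z q * (Zval z q)^* = (1 - z ^+ (n`_p^')%N) ^+ (2 * k) * Zval z s ->
  exists r, Zval z q = (1 - z ^+ (n`_p^')%N) ^+ k * Zval z r.
Proof.
move=> prim_z p_pr p_n j_gt0 Dj; elim: k q s => [|k IHk] q s Dqs.
  by exists q; rewrite mul1r.
have n_gt0 := prim_order_gt0 prim_z; move: Dqs; set w := z ^+ _.
have z_nz : z != 0.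
  apply: contraTneq (oner_neq0 algC) => z0.
  by rewrite -(prim_expr_order prim_z) z0 expr0n gtn_eqF ?eqxx.
have w_nz : w != 0 by rewrite expf_neq0.
have w1_nz : 1 - w != 0.
  rewrite subr_eq0 eq_sym -(prim_order_dvd prim_z).
  have := part_pnat p^' n; rewrite p'natE //; apply: contra.
  exact: dvdn_trans.
rewrite mulnS add2n => Dqs.
have [|t Dt] := @dvd_of_dvd_norm n p j z q
    ((1 - 'X^(n`_p^')%N) ^+ (2 * k).+1 * s) prim_z p_pr p_n j_gt0 Dj.
  by rewrite Dqs exprS rmorphM rmorphXn /= Zval_1_sub mulrA.
have conj_w : (1 - w)^* = - w^-1 * (1 - w).
  rewrite rmorphB rmorph1 rmorphXn /= (conj_prim_root prim_z).
  have -> : z ^+ n.-1 = z^-1.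
    by apply: (mulfI z_nz); rewrite -exprS prednK // prim_expr_order ?divff.
  by rewrite exprVn -/w; field.
(* The factor -X^(n') evaluates to -w and cancels the unit -w^-1. *)
have [|r Dr] := IHk t (- 'X^(n`_p^')%N * s).
  rewrite -/w rmorphM rmorphN /= Zval_Xn -/w.
  have nz2 : - w^-1 * (1 - w) ^+ 2 != 0 by rewrite mulf_neq0 ?oppr_eq0 ?invr_eq0 ?expf_neq0.
  apply: (mulfI nz2).
  transitivity (Zval z q * (Zval z q)^* ).
    by rewrite Dt -/w rmorphM /= conj_w; ring.
  by rewrite Dqs !exprS; field.
by exists r; rewrite Dt Dr -/w exprS mulrA.
Qed.

(** Ramification gives p^2 an even power (1 - w)^(2e); descent leaves (1 - w)^e, which is again a
    multiple of p. *)
Lemma Turyn_self_conjugate (n p j : nat) (z : algC) (q s : {poly int}) :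
    n.-primitive_root z -> prime p -> (p %| n)%N -> (0 < j)%N ->
    (p ^ j = n.-1 %[mod n`_p^'])%N ->
    Zval z q * (Zval z q)^* = p%:R ^+ 2 * Zval z s ->
  exists r, Zval z q = p%:R * Zval z r.
Proof.
move=> prim_z p_pr p_n j_gt0 Dj Dqs; 
have [e [r [t [_ Dp De]]]] := prime_ramified_prim_root prim_z p_pr p_n.
have [|u ->] := @dvd_exp_of_dvd_norm n p j e z q (r ^+ 2 * s) prim_z p_pr p_n j_gt0 Dj.
  by rewrite Dqs Dp rmorphM rmorphXn /= mulnC exprM; ring.
by exists (t * u); rewrite De rmorphM mulrA.
Qed.

(** * Traces and congruences between Fourier coefficients *)

Lemma sum_expr_unity_root (m : nat) (x : algC) : x ^+ m = 1 ->
  \sum_(t < m) x ^+ t = if x == 1 then m%:R else 0.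
Proof.
move=> xm; case: eqP => [->|/eqP x1].
  by under eq_bigr do rewrite expr1n; rewrite sumr_const card_ord.
apply: (mulfI (_ : x - 1 != 0)); first by rewrite subr_eq0.
by rewrite -subrX1 xm subrr mulr0.
Qed.

(** The exponents are all classes modulo n that are 1 modulo n', including those divisible by p.
    This keeps the sum a full geometric one, which projects onto roots of unity of order prime to
    p. *)
Lemma sum_expr_arith_prog (n p : nat) (x : algC) : (0 < n)%N -> x ^+ n = 1 ->
  \sum_(t < (n`_p)%N) x ^+ (1 + n`_p^' * t)%N 
    = (n`_p)%N%:R * (if x ^+ (n`_p^')%N == 1 then x else 0).
Proof.
move=> n_gt0 xn; under eq_bigr do rewrite exprD expr1 exprM.
rewrite -mulr_sumr sum_expr_unity_root; first by case: ifP => _; rewrite ?mulr0 // mulrC.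
by rewrite -exprM mulnC partnC.
Qed.

Lemma Aint_Zval (n : nat) (z : algC) (q : {poly int}) :
  n.-primitive_root z -> Zval z q \in Aint.
Proof.
move=> prim_z; rewrite /Zval /= /horner_eval horner_coef rpred_sum // => i _.
rewrite coef_map /= rpredM ?rpredX ?Aint_int ?rpred_int //.
exact: Aint_prim_root prim_z.
Qed.

(* The trace of (1 - o) Z[z] over Z[z ^+ n`_p] is divisible by n`_p. *)
Lemma trace_dvd (n p : nat) (z o : algC) (q : {poly int}) :
    n.-primitive_root z -> o ^+ n = 1 ->
  exists2 c, c \in Aint &
    \sum_(t < (n`_p)%N) (1 - o ^+ (1 + n`_p^' * t)%N) * Zval (z ^+ (1 + n`_p^' * t)%N) q
      = (n`_p)%N%:R * c.
Proof.
move=> prim_z on; have n_gt0 := prim_order_gt0 prim_z.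
(* Up to the factor n_p, [c0] is the sum of [sum_expr_arith_prog]; it is applied to the monomials
   z^i and z^i o from the expansion of (1 - o) q(z). *)
pose c0 (x : algC) := if x ^+ (n`_p^')%N == 1 then x else 0.
exists (\sum_(i < size q) (c0 (z ^+ i) - c0 (z ^+ i * o)) * (q`_i)%:~R).
  rewrite rpred_sum // => i _.
  have Ac0 (x : algC) : x ^+ n = 1 -> c0 x \in Aint.
    rewrite /c0 => xn; case: ifP => _; last exact: rpred0.
    by apply: (@Aint_unity_root n) => //; apply/unity_rootP.
  have zin : (z ^+ i) ^+ n = 1 by rewrite -exprM mulnC exprM (prim_expr_order prim_z) expr1n.
  rewrite rpredM ?rpredB ?Ac0 ?Aint_int ?rpred_int // ?exprMn ?zin ?on ?mulr1 //.
rewrite mulr_sumr.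
under eq_bigr => t _.
  rewrite /Zval /= /horner_eval horner_coef.
  rewrite size_map_inj_poly ?rmorph0 //; last exact: intr_inj.
  rewrite mulr_sumr; over.
rewrite exchange_big /=; apply: eq_bigr => i _.
have zin : (z ^+ i) ^+ n = 1 by rewrite -exprM mulnC exprM (prim_expr_order prim_z) expr1n.
rewrite mulrA mulrBr -!sum_expr_arith_prog // ?exprMn ?zin ?on ?mulr1 //.
rewrite -sumrB mulr_suml; apply: eq_bigr => t _.
rewrite coef_map /= exprMn -!exprM (mulnC i); ring.
Qed.

(** After multiplication by n_p, the left side is the sum over k = 1 + n' t of (1 - o^k) times the
    sum of the a_i^k. Galois conjugation replaces the latter by p q(z^k), and [trace_dvd] gives back
    the factor n_p. *)
Lemma Fourier_cong (n p : nat) (z o : algC) (q : {poly int}) (I : finType)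
    (P : pred I) (a : I -> algC) :
    n.-primitive_root z -> prime p -> (p %| n)%N -> o ^+ p = 1 ->
    (forall i, P i -> a i ^+ n = 1) ->
    \sum_(i | P i) a i = p%:R * Zval z q ->
  exists2 c, c \in Aint &
    \sum_(i | P i && (a i ^+ (n`_p^')%N == 1)) a i
      - \sum_(i | P i && ((a i * o) ^+ (n`_p^')%N == 1)) a i * o = p%:R * c.
Proof.
move=> prim_z p_pr p_n op an Dq; have n_gt0 := prim_order_gt0 prim_z.
have on : o ^+ n = 1 by rewrite -(divnK p_n) mulnC exprM op expr1n.
have [c Ac Dc] := trace_dvd p q prim_z on; exists c => //.
have m_nz : (n`_p)%N%:R != 0 :> algC by rewrite pnatr_eq0 -lt0n part_gt0.
apply: (mulfI m_nz); rewrite mulrCA -Dc mulr_sumr.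
transitivity (\sum_(t < (n`_p)%N) \sum_(i | P i)
    (a i ^+ (1 + n`_p^' * t)%N - (a i * o) ^+ (1 + n`_p^' * t)%N)).
  rewrite exchange_big /= mulrBr !big_mkcondr /= !mulr_sumr -sumrB.
  apply: eq_bigr => i Pi; rewrite sumrB !sum_expr_arith_prog ?an //.
  by rewrite exprMn an ?on ?mulr1.
apply: eq_bigr => t _; set k := (1 + _)%N.
have -> : \sum_(i | P i) (a i ^+ k - (a i * o) ^+ k) = (1 - o ^+ k) * \sum_(i | P i) a i ^+ k.
  by rewrite mulr_sumr; apply: eq_bigr => i _; rewrite exprMn; ring.
(* For p | k no automorphism raises z to the power k, but then 1 - o^k = 0. *)
have [p_k|p'k] := boolP (p %| k)%N.
  by rewrite -(divnK p_k) mulnC !exprM op expr1n subrr !mul0r mulr0.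
rewrite mulrCA; congr (_ * _).
have co_kn : coprime k n.
  rewrite -(partnC p n_gt0) coprimeMr; apply/andP; split.
    by rewrite p_part coprimeXr // coprime_sym prime_coprime.
  by rewrite /k addnC mulnC coprime_sym /coprime gcdnMDl gcdn1.
have [u Du] := Qn_aut_exists co_kn.
rewrite -Du ?prim_expr_order // -rmorph_Zval -(rmorph_nat u p) -rmorphM -Dq rmorph_sum.
by apply: eq_bigr => i /an /Du.
Qed.

(** * From divisible character sums to translation invariance *)

Lemma prime_dvd_exponent (gT : finGroupType) (G : {group gT}) (p : nat) :
  prime p -> (p %| #|G|)%N -> (p %| exponent G)%N.
Proof.
move=> p_pr p_G; have : p \in primes (exponent G).
  by rewrite primes_exponent mem_primes p_pr cardG_gt0.
by rewrite mem_primes => /and3P[].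
Qed.

(** Here c is rational, and a rational algebraic integer is an integer. *)
Lemma dvdn_of_Aint (p a : nat) (c : algC) :
  (0 < p)%N -> c \in Aint -> a%:R = p%:R * c -> (p %| a)%N.
Proof.
move=> p_gt0 Ac Da; have p_nz : p%:R != 0 :> algC by rewrite pnatr_eq0 -lt0n.
have Dc : c = a%:R / p%:R by rewrite Da mulrC mulKf.
have /intrP[m Dm] : c \in Num.int.
  by apply: Cint_rat_Aint => //; rewrite Dc rpred_div ?rpred_nat.
rewrite -(dvdC_nat p a); apply/dvdCP; exists c; last by rewrite mulrC -Da.
by apply/intrP; exists m.
Qed.

Lemma sum_irr_abelian (gT : finGroupType) (H : {group gT}) (h : gT) :
  abelian H -> \sum_(i : Iirr H) 'chi_i h = #|H|%:R *+ (h == 1%g).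
Proof.
move=> abH; rewrite -cfRegE cfReg_sum sum_cfunE; apply: eq_bigr => i _.
by rewrite cfunE lin_char1 ?mul1r //; apply/char_abelianP.
Qed.

(** Ma's lemma. For a faithful character of P times any character of H = O_p'(G), [Fourier_cong]
    compares the parts of S in Hx and Hgx modulo p. Summing over the characters of H turns these
    parts into |H| [x in S] and |H| [gx in S], and |H| is prime to p. *)
Lemma translate_stable_of_dvd_char_sum (gT : finGroupType) (G P : {group gT})
    (p : nat) (z : algC) (S : {set gT}) :
    abelian G -> prime p -> p.-Sylow(G)%g P -> cyclic P ->
    (p %| #|G|)%N -> (exponent G).-primitive_root z -> S \subset G ->
    (forall chi : 'CF(G), chi \is a linear_char ->
      exists q, char_sum chi S = p%:R * Zval z q) ->
  exists g, [/\ g \in G, #[g]%g = p & {in G, forall x, (g * x \in S)%g = (x \in S)}].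
Proof.
move=> abG p_pr sylP cycP p_G prim_z sSG dvS.
have [sPG pP _] := and3P sylP.
have nsPG : (P <| G)%g by rewrite -sub_abelian_normal.
pose H := 'O_p^'(G)%G; set n := exponent G in prim_z.
have n_gt0 : (0 < n)%N := exponent_gt0 G.
have p_n : (p %| n)%N := prime_dvd_exponent p_pr p_G.
have dxPH : (P \x H = G)%g.
  by rewrite -{1}(normal_Hall_pcore sylP nsPG) nilpotent_pcoreC ?abelian_nil.
have hallH : p^'.-Hall(G)%g H := nilpotent_pcore_Hall _ (abelian_nil abG).
have sHG : H \subset G := pcore_sub _ _.
have abH : abelian H := abelianS sHG abG.
have [g Pg og] : {g | g \in P & #[g]%g = p}.
  apply: Cauchy => //; rewrite (card_Hall sylP) p_part.
  by rewrite -{1}(expn1 p) dvdn_exp2l // logn_gt0 mem_primes p_pr cardG_gt0.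
have Gg := subsetP sPG g Pg.
(* This is where cyclicity of P is essential. *)
have [i0 fi0] : exists i, cfaithful 'chi[P]_i.
  by apply: pgroup_cyclic_faithful pP _; apply: cyclicS cycP; apply: center_sub.
pose chi i := cfDprod dxPH 'chi_i0 'chi[H]_i.
have lin0 : 'chi_i0 \is a linear_char by apply/char_abelianP/cyclic_abelian.
have linH i : 'chi[H]_i \is a linear_char by apply/char_abelianP.
have lin_chi i : chi i \is a linear_char by apply: cfDprod_lin_char.
have chi_H i h : h \in H -> chi i h = 'chi_i h.
  by move=> Hh; rewrite -{1}[h]mul1g /chi cfDprodE ?group1 // lin_char1 ?mul1r.
(* By faithfulness on P, the order condition in [Fourier_cong] selects exactly H. *)
have ker_chi i y : y \in G -> (chi i y ^+ (n`_p^')%N == 1) = (y \in H).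
  move=> Gy; have Hn' h : h \in H -> (h ^+ n`_p^')%g = 1%g.
    by move=> Hh; rewrite -(exponent_Hall hallH) expg_exponent.
  rewrite -lin_charX //; apply/eqP/idP => [|Hy]; last by rewrite Hn' ?lin_char1.
  have [k [h [Pk Hh -> _]]] := mem_dprod dxPH Gy.
  have ckh : commute k h := (centsP abG _ (subsetP sPG _ Pk) _ (subsetP sHG _ Hh)).
  rewrite expgMn // (Hn' h) // /chi cfDprodE ?groupX ?group1 //.
  rewrite [X in _ * X]lin_char1 // mulr1 => chik.
  have /eqP : (k ^+ n`_p^')%g = 1%g.
    apply/set1P; apply: (subsetP fi0).
    by rewrite cfkerEirr inE chik lin_char1.
  rewrite -order_dvdn => k_n'; suff -> : k = 1%g by rewrite mul1g.
  apply/eqP; rewrite -order_eq1 -dvdn1 -(eqP (_ : coprime #[k]%g n`_p^')).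
    by rewrite dvdn_gcd dvdnn.
  by apply: pnat_coprime (mem_p_elt pP Pk) (part_pnat _ _).
have chi_n i y : y \in G -> chi i y ^+ n = 1.
  by move=> Gy; rewrite -lin_charX // expg_exponent ?lin_char1.
have sum_chi x : x \in G ->
  \sum_i \sum_(s in S | (s * x^-1 \in H)%g) chi i (s * x^-1)%g = #|H|%:R *+ (x \in S).
  move=> Gx; rewrite exchange_big /=.
  transitivity (\sum_(s in S | (s * x^-1 \in H)%g) #|H|%:R *+ (s == x) : algC).
    apply: eq_bigr => s /andP[_ Hs]; under eq_bigr => i _ do rewrite chi_H //.
    by rewrite sum_irr_abelian // -eq_mulgV1.
  have [Sx|Sx] := boolP (x \in S).
    rewrite (bigD1 x) ?Sx ?mulgV ?group1 //= ?eqxx big1 ?addr0 ?eqxx // => s.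
    by case/andP=> _ /negPf->.
  by rewrite big1 // => s /andP[Ss _]; case: eqP => // Dx; rewrite -Dx Ss in Sx.
exists g; split=> // x Gx.
have main i : exists2 c, c \in Aint &
    \sum_(s in S | (s * x^-1 \in H)%g) chi i (s * x^-1)%g
    - \sum_(s in S | (s * (g * x)^-1 \in H)%g) chi i (s * (g * x)^-1)%g = p%:R * c.
  have Gs s : s \in S -> s \in G by apply: (subsetP sSG).
  have GsV y s : y \in G -> s \in S -> (s * y^-1)%g \in G.
    by move=> Gy Ss; rewrite groupM ?groupV ?(Gs s).
  have [q Dq] := dvS _ (lin_chi i).
  (* Translating S by x^-1 multiplies its character sum by chi(x^-1) = z^j, hence the polynomial by
     X^j. *)
  have [j Dj] := prim_rootP prim_z (chi_n i x^-1%g (groupVr Gx)).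
  have op : chi i g^-1%g ^+ p = 1.
    by rewrite -lin_charX ?groupV // expgVn -og expg_order invg1 lin_char1.
  have an s : s \in S -> chi i (s * x^-1)%g ^+ n = 1.
    by move=> Ss; rewrite chi_n ?GsV.
  have [|c Ac Dc] := @Fourier_cong n p z (chi i g^-1%g) ('X^j * q) _ (mem S)
      (fun s => chi i (s * x^-1)%g) prim_z p_pr p_n op an.
    rewrite rmorphM /= Zval_Xn -Dj mulrCA -Dq mulr_sumr.
    by apply: eq_bigr => s Ss; rewrite lin_charM ?groupV ?(Gs s) // mulrC.
  exists c => //; rewrite -Dc; congr (_ - _).
    by apply: eq_bigl => s; apply: andb_id2l => Ss; rewrite ker_chi ?GsV.
  have chiM s : s \in S -> chi i (s * x^-1)%g * chi i g^-1%g = chi i (s * (g * x)^-1)%g.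
    by move=> Ss; rewrite invMg mulgA [RHS]lin_charM ?GsV ?groupV.
  apply: eq_big => [s|s /andP[Ss _]]; last by rewrite chiM.
  by apply: andb_id2l => Ss; rewrite chiM // ker_chi //; apply: GsV; rewrite ?groupM.
have [c Ac Dc] : exists2 c, c \in Aint
    & #|H|%:R *+ (x \in S) - #|H|%:R *+ (g * x \in S)%g = p%:R * c.
  rewrite -!sum_chi ?groupM // -sumrB.
  apply: (big_ind (fun y => exists2 c, c \in Aint & y = p%:R * c)) => [|y1 y2|].
  - by exists 0; rewrite ?rpred0 ?mulr0.
  - by move=> [c1 A1 ->] [c2 A2 ->]; exists (c1 + c2); rewrite ?rpredD ?mulrDr.
  by move=> i _; apply: main.
have p'H : ~~ (p %| #|H|)%N by rewrite -p'natE //; apply: pcore_pgroup.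
apply: contraNeq p'H => neq_xS.
have p_gt0 := prime_gt0 p_pr.
move: Dc neq_xS; case: (x \in S); case: (_ \in S) => //=; rewrite ?subr0 ?sub0r => Dc _.
  exact: dvdn_of_Aint Dc.
by apply: (@dvdn_of_Aint p #|H| (- c)); rewrite ?rpredN // mulrN -Dc opprK.
Qed.

(** * Orthogonality on the dual group and |S| |T| = |G| *)

Lemma sum_dual_isomorphism (gT : finGroupType) (G : {group gT})
    (Delta : gT -> 'CF(G)) (c : gT) :
    abelian G -> dual_isomorphism Delta -> c \in G ->
  \sum_(y in G) Delta y c = #|G|%:R *+ (c == 1%g).
Proof.
move=> abG [linD morD _ surjD] Gc; case: eqP => [->|/eqP nt_c].
  under eq_bigr => y Gy do rewrite lin_char1 ?linD //.
  by rewrite sumr_const.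
(* If all characters were 1 at c, the regular character would not vanish there. Shifting the index
   by the preimage of such a character multiplies the sum by a value other than 1. *)
have [i chi_c] : exists i : Iirr G, 'chi_i c != 1.
  apply/existsP; rewrite -negb_forall; apply: contra nt_c => /forallP all1.
  have := sum_irr_abelian c abG; under eq_bigr => i _ do rewrite (eqP (all1 i)).
  rewrite sumr_const; case: eqP => // _ /eqP.
  by rewrite mulr0n pnatr_eq0 card_ord NirrE eqn0Ngt classes_gt0.
have /surjD[y0 Gy0 Dy0] : 'chi_i \is a linear_char by apply/char_abelianP.
apply: (mulfI (_ : 'chi_i c - 1 != 0)); first by rewrite subr_eq0.
rewrite mulr0 mulrBl mul1r; apply/eqP; rewrite subr_eq0; apply/eqP.
rewrite mulr_sumr [RHS](reindex_inj (mulgI y0)) /=.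
apply: eq_big => [y|y Gy]; first by rewrite groupMl.
by rewrite morD // cfunE Dy0.
Qed.

(** Parseval: in the expanded square, orthogonality removes all pairs with s different from t. *)
Lemma sum_norm_char_sum (gT : finGroupType) (G : {group gT})
    (Delta : gT -> 'CF(G)) (S : {set gT}) :
    abelian G -> dual_isomorphism Delta -> S \subset G ->
  \sum_(y in G) `|char_sum (Delta y) S| ^+ 2 = #|S|%:R * #|G|%:R.
Proof.
move=> abG isoD sSG; have [linD _ _ _] := isoD.
have Gs s : s \in S -> s \in G by apply: (subsetP sSG).
transitivity (\sum_(y in G) \sum_(s in S) \sum_(t in S) Delta y (s * t^-1)%g).
  apply: eq_bigr => y Gy; rewrite normCK rmorph_sum /= /char_sum mulr_suml.
  apply: eq_bigr => s Ss; rewrite mulr_sumr; apply: eq_bigr => t St.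
  by rewrite -lin_charV_conj ?linD ?(Gs t) // [RHS]lin_charM ?linD ?groupV ?(Gs t) ?(Gs s).
rewrite exchange_big /= mulr_natl -sumr_const; apply: eq_bigr => s Ss.
rewrite exchange_big /= (bigD1 s) //= [X in _ + X]big1 => [|t /andP[St ts]].
  by rewrite mulgV sum_dual_isomorphism // eqxx addr0.
rewrite sum_dual_isomorphism ?groupM ?groupV ?(Gs s) ?(Gs t) //.
by rewrite -eq_mulgV1 eq_sym (negPf ts).
Qed.

Lemma sum_weight (gT : finGroupType) (G : {group gT}) (T : {set gT}) :
  T \subset G -> (\sum_(y in G) weight T y = #|T| ^ 2)%N.
Proof.
move=> sTG; rewrite -mulnn -cardsX -sum1_card.
rewrite (partition_big (fun a : gT * gT => (a.1 * a.2^-1)%g) (mem G)) /=.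
  apply: eq_bigr => y _; rewrite /weight -sum1_card; apply: eq_bigl => a.
  by rewrite !inE [y == _]eq_sym.
by move=> [a b]; rewrite !inE /= => /andP[Ta Tb]; rewrite groupM ?groupV ?(subsetP sTG).
Qed.

(** Summing the first duality identity over G gives |S| |G| = |S|^2 |T|, by Parseval and
    [sum_weight]. *)
Lemma card_formally_dual (gT : finGroupType) (G : {group gT})
    (Delta : gT -> 'CF(G)) (S T : {set gT}) :
    abelian G -> dual_isomorphism Delta -> formally_dual Delta S T ->
  S != set0 -> (#|S| * #|T| = #|G|)%N.
Proof.
move=> abG isoD [sSG sTG dualST] ntS.
have S_nz : #|S|%:R != 0 :> algC by rewrite pnatr_eq0 cards_eq0.
have G_nz : #|G|%:R != 0 :> algC by rewrite pnatr_eq0 -lt0n cardG_gt0.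
have := sum_norm_char_sum abG isoD sSG.
under eq_bigr => y Gy do rewrite (dualST y Gy).1.
rewrite -mulr_sumr -natr_sum sum_weight //.
(* If T were empty, the convention that 0 has inverse 0 would force |S| |G| = 0. *)
have [-> /esym/eqP|T_nz] := eqVneq (#|T|%:R : algC) 0.
  by rewrite invr0 mulr0 mul0r mulf_eq0 (negPf S_nz) (negPf G_nz).
move=> DG; apply/eqP; rewrite -(eqr_nat algC) natrM; apply/eqP.
by apply: (mulfI S_nz); rewrite -DG natrX; field.
Qed.

(** * The valuation bound and the conclusion *)

Lemma self_conjugate_exp (p n : nat) : prime p -> (0 < n)%N -> self_conjugate p n ->
  exists2 j, (0 < j)%N & (p ^ j = n.-1 %[mod n`_p^'])%N.
Proof.
move=> p_pr n_gt0 [j Dj].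
have co_p : coprime p n`_p^' by rewrite prime_coprime // -p'natE ?part_pnat.
(* The exponent in [self_conjugate] may be 0; adding the totient makes it positive without changing
   the residue, by Euler's theorem. *)
exists (j + totient n`_p^')%N; first by rewrite addn_gt0 totient_gt0 part_gt0 orbT.
rewrite expnD -modnMmr Euler_exp_totient // modnMmr muln1; apply/eqP.
rewrite -(eqn_modDr 1) !addn1 prednK //.
rewrite (eqP (dvdn_part _ n)) -/(dvdn _ _).
by move/eqP: Dj; rewrite eqz_mod_dvd opprK -natz -natrX natz -(PoszD _ 1) addn1 dvdzE.
Qed.

Lemma cover_rcosets_of_stable (gT : finGroupType) (G : {group gT}) (g : gT) (S : {set gT}) :
    g \in G -> S \subset G -> {in G, forall x, (g * x \in S)%g = (x \in S)} ->
  exists2 C : {set {set gT}}, C \subset rcosets <[g]> G & S = cover C.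
Proof.
move=> Gg sSG stab.
have stabX i x : x \in G -> (g ^+ i * x \in S)%g = (x \in S).
  move=> Gx; elim: i => [|i IHi]; first by rewrite mul1g.
  by rewrite expgS -mulgA stab ?IHi ?groupM ?groupX.
exists [set (<[g]> :* x)%g | x in S].
  by apply/subsetP=> _ /imsetP[x Sx ->]; apply/rcosetsP; exists x; rewrite ?(subsetP sSG).
apply/setP=> x; rewrite /cover; apply/idP/bigcupP => [Sx|].
  by exists (<[g]> :* x)%g; [apply: imset_f | apply: rcoset_refl].
case=> _ /imsetP[y Sy ->] /rcosetP[_ /cycleP[i ->] ->].
by rewrite stabX ?(subsetP sSG).
Qed.

(** Only one of the two duality identities is assumed, so the bound applies again with S and T
    exchanged. *)
Lemma dual_valuation_bound (gT : finGroupType) (G P : {group gT}) (p : nat)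
    (Delta : gT -> 'CF(G)) (S T : {set gT}) (l1 l2 : nat) :
    abelian G -> prime p -> (p %| #|G|)%N -> p.-Sylow(G)%g P -> cyclic P ->
    self_conjugate p (exponent G) -> dual_isomorphism Delta ->
    S \subset G -> T != set0 ->
    {in G, forall y, `|char_sum (Delta y) S| ^+ 2
      = #|S|%:R ^+ 2 / #|T|%:R * (weight T y)%:R} ->
    primitive_subset G S ->
    (#|S|`_p = p ^ l1)%N -> (#|T|`_p = p ^ l2)%N ->
  (2 * l1 <= l2.+1)%N.
Proof.
move=> abG p_pr p_G sylP cycP selfc isoD sSG ntT dualS [_ primS] Sp Tp.
rewrite leqNgt; apply/negP => lt_l.
have n_gt0 := exponent_gt0 G.
have p_n := prime_dvd_exponent p_pr p_G.
have [z prim_z] := C_prim_root_exists n_gt0.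
have [j j_gt0 Dj] := self_conjugate_exp p_pr n_gt0 selfc.
have [linD morD _ surjD] := isoD.
have T_nz : #|T|%:R != 0 :> algC by rewrite pnatr_eq0 cards_eq0.
have in_Zz (chi : 'CF(G)) : chi \is a linear_char -> exists q, char_sum chi S = Zval z q.
  move=> lin_chi; rewrite /char_sum.
  apply: (big_ind (fun y => exists q, y = Zval z q)) => [|_ _ [q1 ->] [q2 ->]|s Ss].
  - by exists 0; rewrite rmorph0.
  - by exists (q1 + q2); rewrite rmorphD.
  have Gs := subsetP sSG s Ss.
  have [|i ->] := @prim_rootP _ _ z prim_z (chi s).
    by rewrite -lin_charX // expg_exponent // lin_char1.
  by exists 'X^i; rewrite Zval_Xn.
have [g [Gg og stab]] : exists g, [/\ g \in G, #[g]%g = p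
    & {in G, forall x, (g * x \in S)%g = (x \in S)}].
  apply: (translate_stable_of_dvd_char_sum abG p_pr sylP cycP p_G prim_z sSG) => chi lin_chi.
  have [q Dq] := in_Zz chi lin_chi; rewrite Dq.
  have [y Gy Dy] := surjD chi lin_chi.
  have normE : Zval z q * (Zval z q)^* = #|S|%:R ^+ 2 / #|T|%:R * (weight T y)%:R.
    by rewrite -normCK -Dq -Dy dualS.
  (* The squared modulus is rational by duality, an algebraic integer and nonnegative, hence a
     natural number. *)
  have /natrP[N DN] : Zval z q * (Zval z q)^* \in Num.nat.
    rewrite natrEint mul_conjC_ge0 andbT; apply: Cint_rat_Aint.
      by rewrite normE !(rpredM, rpredX, rpredV, rpred_nat).
    rewrite (conj_Zval _ prim_z); apply: rpredM; exact: Aint_Zval prim_z.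
  have eqN : (#|T| * N = #|S| ^ 2 * weight T y)%N.
    apply/eqP; rewrite -(eqr_nat algC) !natrM -DN normE; apply/eqP.
    by field.
  (* In |T| N = |S|^2 [weight T y] the right side is divisible by p^(2 l1), while |T| absorbs only
     p^l2, and 2 l1 >= l2 + 2. *)
  have /dvdnP[m Dm] : (p ^ 2 %| N)%N.
    rewrite -(@dvdn_pmul2l (p ^ l2)) ?expn_gt0 ?prime_gt0 // -expnD.
    rewrite -(@Gauss_dvdr _ (#|T|`_p^')%N); last first.
      by rewrite coprimeXl // prime_coprime // -p'natE ?part_pnat.
    rewrite mulnA -Tp [(_ * #|T|`_p)%N]mulnC partnC ?card_gt0 // eqN dvdn_mulr //.
    apply: (@dvdn_trans ((#|S|`_p) ^ 2)%N); last by rewrite dvdn_exp2r ?dvdn_part.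
    by rewrite Sp -expnM dvdn_exp2l //; move: lt_l; clear; lia.
  apply: (Turyn_self_conjugate (s := m%:R) prim_z p_pr p_n j_gt0 Dj).
  by rewrite DN Dm natrM natrX rmorph_nat mulrC.
have [C sC DS] := cover_rcosets_of_stable Gg sSG stab.
apply: primS sC DS; first by rewrite cycle_subG.
by rewrite -cardG_gt1 -/(order g) og prime_gt1.
Qed.

Local Close Scope ring_scope.
Import GroupScope.

Theorem theorem5p8 (gT : finGroupType) (G P : {group gT}) (p : nat)
    (Delta : gT -> 'CF(G)) (S T : {set gT}) (l1 l2 : nat)
    (abelG : abelian G)
    (p_prime : prime p) (p_dvd_G : p %| #|G|)
    (sylP : p.-Sylow(G) P) (cycP : cyclic P)
    (p_selfconj : self_conjugate p (exponent G))
    (isoDelta : dual_isomorphism Delta)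
    (dualST : formally_dual Delta S T)
    (primS : primitive_subset G S) (primT : primitive_subset G T)
    (p_part_S : (#|S|`_p = p ^ l1)%N) (p_part_T : (#|T|`_p = p ^ l2)%N) :
  [/\ l1 = 1%N, l2 = 1%N & (#|G|`_p = p ^ 2)%N].
Proof.
have [sSG sTG dual] := dualST.
have ltG : 1%G \proper G.
  rewrite properEneq sub1G andbT eq_sym -cardG_gt1.
  by rewrite (leq_trans (prime_gt1 p_prime)) // dvdn_leq.
have nt (A : {set gT}) : primitive_subset G A -> A != set0.
  by case=> /(_ _ 1 ltG (group1 G)) + _; apply: contraNneq => ->; rewrite sub0set.
have [ntS ntT] := (nt S primS, nt T primT).
have le_l1 : (2 * l1 <= l2.+1)%N.
  apply: (dual_valuation_bound abelG p_prime p_dvd_G sylP cycP p_selfconj isoDelta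
            sSG ntT _ primS p_part_S p_part_T) => y Gy.
  exact: (dual y Gy).1.
have le_l2 : (2 * l2 <= l1.+1)%N.
  apply: (dual_valuation_bound abelG p_prime p_dvd_G sylP cycP p_selfconj isoDelta
            sTG ntS _ primT p_part_T p_part_S) => y Gy.
  exact: (dual y Gy).2.
have Gp : (#|G|`_p = p ^ (l1 + l2))%N.
  rewrite -(card_formally_dual abelG isoDelta dualST ntS).
  by rewrite partnM ?card_gt0 // p_part_S p_part_T expnD.
have l_gt0 : (0 < l1 + l2)%N.
  rewrite lt0n; apply: contraTneq p_dvd_G => l0; rewrite -p'natE //.
  by rewrite -partn_eq1 // Gp l0.
(* The two bounds add up to l1 + l2 <= 2, and (1,1) is the only nonzero pair satisfying both. *)
have [Dl1 Dl2] : l1 = 1%N /\ l2 = 1%N.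
  by move: le_l1 le_l2 l_gt0; clear; lia.
by rewrite Gp Dl1 Dl2.
Qed.
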